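(* Let $\mathbb K$ be $\mathbb R$ or $\mathbb C$, let $G\subseteq GL(n,\mathbb K)$ be a toral group, and let $B\in\mathbb K^{(n,n)}$ be a semisimple matrix such that $\{\exp(tB);\ t\in\mathbb R\}$ is Zariski-dense in $G$. Then the following hold. (a) $I(B)$ is a finitely generated $\mathbb K$-algebra, and $I(B)=I(G)$. (b) For every $\chi\in\mathbb K$ the $I(B)$-module $I_\chi(B)$ is finitely generated. (c) The $I(B)$-module $\mathcal C(B)$ is finitely generated.
   Context: A linear algebraic group is a subgroup of $GL(n,\mathbb K)$ which is also an algebraic subvariety. A connected linear algebraic group $G\subseteq GL(n,\mathbb K)$ is called toral if there exists a semisimple $B\in\mathbb K^{(n,n)}$ (diagonalizable over $\mathbb C$) such that $\{\exp(tB);\ t\in\mathbb R\}$ is Zariski-dense in $G$. For a polynomial $\phi\in\mathbb K[x_1,\ldots,x_n]$, the Lie derivative with respect to the linear vector field $x\mapsto Bx$ is $X_B(\phi)(x)=D\phi(x)Bx$. For polynomial maps (vector fields) $f,g:\mathbb K^n\to\mathbb K^n$ the Lie bracket is $[f,g](x)=Dg(x)f(x)-Df(x)g(x)$; the matrix $B$ is identified with the vector field $x\mapsto Bx$. Define: $I(B)=\{\phi\in\mathbb K[x_1,\ldots,x_n];\ X_B(\phi)=0\}$; $I_\chi(B)=\{\phi\in\mathbb K[x_1,\ldots,x_n];\ X_B(\phi)=\chi\phi\}$ for $\chi\in\mathbb K$; $\mathcal C(B)$ is the set of all polynomial vector fields $p$ on $\mathbb K^n$ with $[B,p]=0$. $I(G)$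 is the set of all polynomials $\varphi:\mathbb K^n\to\mathbb K$ with $\varphi\circ T^{-1}=\varphi$ for all $T\in G$. *)

(* Defs.v *)
From HB Require Import structures.
From mathcomp Require Import all_boot all_order all_algebra.
From mathcomp Require Import complex.
From mathcomp Require Import classical_sets reals topology normedtype sequences.
(* The notations of mpoly clash with those of MathComp-Analysis. *)
From mathcomp Require Import -(notations) mpoly.

Set Implicit Arguments.
Unset Strict Implicit.
Unset Printing Implicit Defensive.

Import GRing.Theory Num.Theory.
Import numFieldNormedType.Exports.

Local Open Scope classical_set_scope.
Local Open Scope ring_scope.

Inductive real_or_complex := OverR | OverC.

Definition ground_field (R : realType) (F : real_or_complex) : numFieldType :=
  match F with OverR => R | OverC => complex R end.

Definition to_complex (R : realType) (F : real_or_complex) :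
    ground_field R F -> complex R :=
  match F with OverR => real_complex R | OverC => id end.

Definition semisimple (R : realType) (F : real_or_complex) (n : nat)
    (B : 'M[ground_field R F]_n) : Prop :=
  diagonalizable (map_mx (@to_complex R F) B).

Section LinearAlgebraicGroups.
Variables (K : numFieldType) (n : nat).
Implicit Types (A B : 'M[K]_n) (G S Z : set 'M[K]_n).

(* The limit is taken in the entrywise topology of 'M[K]_n. *)
Definition mx_exp A : 'M[K]_n :=
  limn (series (fun k : nat => (k`!%:R)^-1 *: A ^+ k)).

(* [t \is Num.real] selects the real scalars inside K. *)
Definition one_parameter_group B : set 'M[K]_n :=
  [set mx_exp (t *: B) | t in [set t : K | t \is Num.real]].

(* Closed subsets of GL(n, K): regular functions on GL(n, K) are polynomials
   in the entries divided by powers of the determinant, so polynomials in the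
   entries are enough to cut out every closed set. *)
Definition zariski_closed Z : Prop :=
  exists P : set (mpoly (n * n) K),
    Z = [set A | A \in unitmx /\
                 forall p, P p -> meval (fun i => mxvec A 0 i) p = 0].

Definition zariski_dense_in S G : Prop :=
  S `<=` G /\ forall Z, zariski_closed Z -> S `<=` Z -> G `<=` Z.

Definition zariski_connected G : Prop :=
  forall Z1 Z2, zariski_closed Z1 -> zariski_closed Z2 ->
    G `<=` Z1 `|` Z2 -> G `&` Z1 `&` Z2 = set0 -> G `<=` Z1 \/ G `<=` Z2.

Definition GL_subgroup G : Prop :=
  [/\ forall A, G A -> A \in unitmx,
      G 1%:M,
      forall A B, G A -> G B -> G (A *m B) &
      forall A, G A -> G (invmx A)].

Definition linear_algebraic_group G : Prop :=
  GL_subgroup G /\ zariski_closed G.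

Definition group_invariants G : set (mpoly n K) :=
  [set phi | forall T, G T -> forall x : 'cV[K]_n,
     meval (fun i => (invmx T *m x) i 0) phi = meval (fun i => x i 0) phi].

End LinearAlgebraicGroups.

Definition toral (R : realType) (F : real_or_complex) (n : nat)
    (G : set 'M[ground_field R F]_n) : Prop :=
  [/\ linear_algebraic_group G,
      zariski_connected G &
      exists B : 'M[ground_field R F]_n,
        semisimple B /\ zariski_dense_in (one_parameter_group B) G].

Section PolynomialVectorFields.
Variables (K : numFieldType) (n : nat).
Local Notation Kx := (mpoly n K).
Implicit Types (B : 'M[K]_n) (phi : Kx) (f g p : 'cV[Kx]_n).

(* The vector field x |-> B x. *)
Definition linear_vf B : 'cV[Kx]_n :=
  map_mx (@mpolyC n K) B *m \col_i @mpolyX n K (mnm1 i).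

Definition jacobian f : 'M[Kx]_n := \matrix_(i, j) mderiv j (f i 0).

Definition lie_derivative B phi : Kx :=
  \sum_j mderiv j phi * linear_vf B j 0.

Definition lie_bracket f g : 'cV[Kx]_n := jacobian g *m f - jacobian f *m g.

Definition invariants B : set Kx := [set phi | lie_derivative B phi = 0].

Definition semi_invariants (chi : K) B : set Kx :=
  [set phi | lie_derivative B phi = chi *: phi].

Definition centralizer B : set 'cV[Kx]_n :=
  [set p | lie_bracket (linear_vf B) p = 0].

Definition fin_gen_subalgebra (A : set Kx) : Prop :=
  [/\ A 1,
      forall (a : K) u v, A u -> A v -> A (a *: u + v),
      forall u v, A u -> A v -> A (u * v) &
      exists (m : nat) (g : m.-tuple Kx),
        (forall i, A (tnth g i)) /\
        forall u, A u -> exists P : mpoly m K, u = comp_mpoly g P].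

End PolynomialVectorFields.

Definition fin_gen_submodule (S : nzRingType) (V : lmodType S) (A : set S)
    (M : set V) : Prop :=
  [/\ M 0,
      forall u v, M u -> M v -> M (u + v),
      forall a u, A a -> M u -> M (a *: u) &
      exists (m : nat) (g : 'I_m -> V),
        (forall i, M (g i)) /\
        forall u, M u -> exists c : 'I_m -> S,
          (forall i, A (c i)) /\ u = \sum_i c i *: g i].

(* Main.v *)
From HB Require Import structures.
Require Import Defs.
From mathcomp Require Import all_boot all_order all_algebra.
From mathcomp Require Import complex.
From mathcomp Require Import boolp classical_sets reals topology normedtype sequences exp.
From mathcomp Require Import ring lra zify.
From mathcomp Require Import -(notations) mpoly.

(* The exponential partial sums are compared through real majorants, so
   cexp (a + b) = cexp a * cexp b over C reduces to the functional equation of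
   the real exponential. In coordinates y = P x that diagonalize B over C, with
   eigenvalues d_i, both X_B and the flow of exp (t B) act diagonally on the
   monomials y^m: X_B multiplies y^m by <d, m> and exp (t B) multiplies it by
   cexp (t <d, m>). Hence X_B phi = 0 iff phi is fixed by the one-parameter group,
   and Zariski density (the stabilizer of phi is closed) gives I(B) = I(G).
   Semi-invariants are spanned by the y^m with <d, m> = chi; by Dickson's lemma
   these exponents have finitely many minimal elements, and subtracting one of
   them lands in the monoid <d, m> = 0. Both I_chi(B) and C(B) are solution
   spaces of X_B w = A w with A diagonalizable, and diagonalizing A splits such a
   space into modules of semi-invariants. Finally K-linear projections C -> K
   (real and imaginary parts when K is real) carry generators over C to
   generators over K. *)

Set Implicit Arguments.
Unset Strict Implicit.
Unset Printing Implicit Defensive.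

Import Order.TTheory GRing.Theory Num.Theory.
Import numFieldNormedType.Exports.

Local Open Scope classical_set_scope.
Local Open Scope ring_scope.

(** * Truncated exponential series over a numeric field *)

Section ExponentialSeries.
Variable K : numFieldType.
Implicit Types (a b z : K) (N k : nat).

Definition exp_sum z N : K := \sum_(k < N) (k`!%:R)^-1 * z ^+ k.

(** The product runs over the square [i, j < N]. The binomial formula identifies its triangle
    [i + j < N] with the truncation at [a + b], which leaves the corner [N <= i + j]. *)
Lemma exp_sumM a b N : exp_sum a N * exp_sum b N = exp_sum (a + b) N +
  \sum_(i < N) \sum_(j < N | (N <= i + j)%N)
     ((i`!%:R)^-1 * a ^+ i) * ((j`!%:R)^-1 * b ^+ j).
Proof.
pose c i j := ((i`!%:R)^-1 * a ^+ i) * ((j`!%:R)^-1 * b ^+ j).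
have -> : exp_sum (a + b) N = \sum_(i < N) \sum_(j < N | (i + j < N)%N) c i j.
  rewrite /exp_sum.
  have fact_neq0 k : (k`!%:R : K) != 0 by rewrite pnatr_eq0 -lt0n fact_gt0.
  have binomE k : (k`!%:R)^-1 * (a + b) ^+ k = \sum_(i < k.+1) c i (k - i)%N.
    rewrite addrC exprDn mulr_sumr; apply: eq_bigr => i _.
    have /(congr1 (fun m => m%:R : K)) := bin_fact (ltn_ord i : i <= k)%N.
    rewrite !natrM => kE; rewrite -kE -mulr_natl /c.
    have := fact_neq0 i; have := fact_neq0 (k - i)%N.
    have : 'C(k, i)%:R != 0 :> K by rewrite pnatr_eq0 -lt0n bin_gt0 -ltnS.
    by move=> u v w; field; rewrite u v w.
  (* Passing from [N] to [N.+1] adds the antidiagonal [i + j = N] to the triangle; the row [i = N]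
     of the smaller triangle is empty. *)
  elim: N => [|N IH]; first by rewrite !big_ord0.
  rewrite big_ord_recr /= IH binomE [RHS](eq_bigr (fun i : 'I_N.+1 =>
    \sum_(j < N.+1 | (i + j < N)%N) c i j + c i (N - i)%N)); last first.
    move=> i _; have iN : (N - i < N.+1)%N by rewrite ltnS leq_subr.
    rewrite (bigD1 (Ordinal iN)) /=; last by rewrite subnKC // -ltnS.
    rewrite addrC; congr (_ + _); apply: eq_bigl => j.
    rewrite -val_eqE /=; have := ltn_ord i; lia.
  rewrite big_split /=; congr (_ + _).
  rewrite big_ord_recr /= [X in _ = _ + X]big_pred0 ?addr0; last first.
    by move=> j; rewrite ltnNge leq_addr.
  apply: eq_bigr => i _; rewrite [RHS]big_mkcond big_ord_recr /=.
  by rewrite ltnNge leq_addl /= addr0 -big_mkcond.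
rewrite /exp_sum mulr_suml -big_split /=; apply: eq_bigr => i _.
rewrite mulr_sumr (bigID (fun j : 'I_N => (i + j < N)%N)) /=.
by congr (_ + _); apply: eq_bigl => j; rewrite -leqNgt.
Qed.

(** Both sides are corner sums of [exp_sumM], compared term by term. This transfers the functional
    equation from real to complex arguments. *)
Lemma ler_norm_exp_sumM a b N :
  `|exp_sum a N * exp_sum b N - exp_sum (a + b) N| <=
  exp_sum `|a| N * exp_sum `|b| N - exp_sum (`|a| + `|b|) N.
Proof.
rewrite !exp_sumM ![exp_sum _ N + _]addrC !addrK.
apply: (le_trans (ler_norm_sum _ _ _)); apply: ler_sum => i _.
apply: (le_trans (ler_norm_sum _ _ _)); apply: ler_sum => j _.
by rewrite !normrM !normrX !normfV !normr_nat.
Qed.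

(** What remains after the terms of order 0 and 1 is bounded termwise. It serves to keep the
    exponential away from 1 at small nonzero arguments. *)
Lemma ler_norm_exp_sumB1 z N : `|exp_sum z N.+2 - 1 - z| <= exp_sum `|z| N.+2 - 1 - `|z|.
Proof.
have E w : exp_sum w N.+2 - 1 - w = \sum_(k < N) ((k.+2)`!%:R)^-1 * w ^+ k.+2.
  rewrite /exp_sum !big_ord_recl /= !fact0 !expr0 !expr1 !invr1 !mul1r.
  by rewrite [1 + _]addrC addrK addrAC subrr add0r.
rewrite !E; apply: (le_trans (ler_norm_sum _ _ _)); apply: ler_sum => i _.
by rewrite normrM normrX normfV normr_nat.
Qed.

End ExponentialSeries.

(* A named structure that simplification does not unfold, so that topologies on
   R[i] are still inferred through numFieldType. *)
Definition complex_field (R : realType) : numFieldType := complex R.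
Arguments complex_field : simpl never.

(** * The exponential function on the complex numbers *)

Section ComplexExponential.
Variable R : realType.
Local Notation C := (complex_field R).
Implicit Types (a b z : C).

Lemma normc_real (x : R) : `|real_complex R x : C| = real_complex R `|x|.
Proof. by rewrite normc_def /= expr0n addr0 sqrtr_sqr. Qed.

Lemma ler_norm_Re z : real_complex R `|complex.Re z| <= `|z|.
Proof.
rewrite normc_def lecR -sqrtr_sqr ler_sqrt ?addr_ge0 ?sqr_ge0 //.
by rewrite lerDl sqr_ge0.
Qed.

Lemma ler_norm_Im z : real_complex R `|complex.Im z| <= `|z|.
Proof.
rewrite normc_def lecR -sqrtr_sqr ler_sqrt ?addr_ge0 ?sqr_ge0 //.
by rewrite lerDr sqr_ge0.
Qed.

Lemma cvg_real_complex (u : R^nat) (l : R) :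
  u @ \oo --> l -> (fun k => real_complex R (u k) : C) @ \oo --> (real_complex R l : C).
Proof.
move=> ul; apply/(@cvgrPdist_lt _ C) => e e_gt0.
(* A positive element of [R[i]] is real, so every tolerance comes from [R]. *)
have [r eE] : exists r, e = real_complex R r.
  by apply/complex_realP; rewrite realE ltW.
move: e_gt0; rewrite {}eE ltcR => r_gt0.
move/cvgrPdist_lt : ul => /(_ r r_gt0); apply: filterS => k.
by rewrite -rmorphB normc_real ltcR.
Qed.

Lemma cvg_Re (u : nat -> C) (l : C) :
  u @ \oo --> l -> (fun k => complex.Re (u k)) @ \oo --> complex.Re l.
Proof.
move=> ul; apply/cvgrPdist_lt => e e_gt0.
move/(@cvgrPdist_lt _ C) : ul => /(_ (real_complex R e)); rewrite ltcR => /(_ e_gt0).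
apply: filterS => k ulk; rewrite -ltcR -raddfB.
exact: le_lt_trans (ler_norm_Re _) ulk.
Qed.

Lemma real_complex_exp_sum (x : R) N :
  real_complex R (exp_sum x N) = exp_sum (real_complex R x : C) N.
Proof.
rewrite /exp_sum rmorph_sum; apply: eq_bigr => k _.
by rewrite rmorphM fmorphV rmorph_nat rmorphXn.
Qed.

Lemma cvg_exp_sumR (x : R) : exp_sum x @ \oo --> expR x.
Proof.
have := @is_cvg_series_exp_coeff R x; rewrite /expR /series /=.
apply: cvg_trans; apply: near_eq_cvg; near=> N.
rewrite big_mkord /exp_sum; apply: eq_bigr => k _.
by rewrite /exp_coeff /= mulrC.
Unshelve. all: by end_near. Qed.

(** Real and imaginary parts are real series dominated by the exponential series at [|z|], hence
    absolutely convergent; the two limits are then recombined. *)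
Lemma cvg_exp_sumC z : cvg (exp_sum z @ \oo).
Proof.
have cvg_part (f : {additive C -> R}) : (forall w, real_complex R `|f w| <= `|w|) ->
    cvg ((fun N => f (exp_sum z N)) @ \oo).
  move=> f_le; have [x xE] : exists x, `|z| = real_complex R x.
    by apply/complex_realP; rewrite normr_real.
  pose c := fun k : nat => f ((k`!%:R)^-1 * z ^+ k).
  rewrite [X in X @ _](_ : _ = series c); last first.
    by apply/funext => N; rewrite /series /= big_mkord raddf_sum.
  apply: normed_cvg; apply: (@series_le_cvg _ _ (exp_coeff x)).
  - by move=> k /=.
  - move=> k; apply: exp_coeff_ge0; rewrite -lecR -xE; exact: normr_ge0.
  - move=> k /=; rewrite -lecR; apply: le_trans (f_le _) _.
    rewrite normrM normrX normfV normr_nat xE /exp_coeff /=.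
    by rewrite rmorphM fmorphV rmorph_nat rmorphXn mulrC.
  - exact: is_cvg_series_exp_coeff.
have [x zx] := proj1 (@cvg_ex R _) (cvg_part (@complex.Re R) ler_norm_Re).
have [y zy] := proj1 (@cvg_ex R _) (cvg_part (@complex.Im R) ler_norm_Im).
apply/cvg_ex; exists (real_complex R x + Complex 0 1 * real_complex R y : C).
rewrite [X in X @ _](_ : _ = fun N => real_complex R (complex.Re (exp_sum z N)) +
  Complex 0 1 * real_complex R (complex.Im (exp_sum z N)) : C); last first.
  by apply/funext => N; exact: complexE.
have iy := cvgMl_tmp (K := C) (FF := eventually_filter) (a := (Complex 0 1 : C))
  (cvg_real_complex zy).
exact: (cvgD (V := C) (cvg_real_complex zx) iy).
Qed.

Definition cexp z : C := lim (exp_sum z @ \oo).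

Lemma cvg_exp_sum z : exp_sum z @ \oo --> cexp z.
Proof. exact: cvg_exp_sumC. Qed.

Lemma cexp0 : cexp 0 = 1.
Proof.
apply: (@cvg_lim C (@norm_hausdorff C C)).
rewrite -cvg_shiftS [X in X @ _](_ : _ = fun=> 1 : C); first exact: cvg_cst.
apply/funext => N; rewrite /= /exp_sum big_ord_recl fact0 expr0 invr1 mulr1 big1 ?addr0 //.
by move=> k _; rewrite expr0n mulr0.
Qed.

Lemma cexpD a b : cexp (a + b) = cexp a * cexp b.
Proof.
have [x xE] : exists x, `|a| = real_complex R x.
  by apply/complex_realP; rewrite normr_real.
have [y yE] : exists y, `|b| = real_complex R y.
  by apply/complex_realP; rewrite normr_real.
have abM : (fun N => exp_sum a N * exp_sum b N) @ \oo --> cexp a * cexp b.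
  exact: (cvgM (K := C) (@cvg_exp_sum a) (@cvg_exp_sum b)).
have diff0 : (fun N => exp_sum a N * exp_sum b N - exp_sum (a + b) N) @ \oo --> (0 : C).
  have real0 : (fun N => exp_sum x N * exp_sum y N - exp_sum (x + y) N) @ \oo --> (0 : R).
    rewrite -(subrr (expR (x + y))) {1}expRD.
    by apply: cvgB; [apply: cvgM|]; exact: cvg_exp_sumR.
  apply/(@cvgr0Pnorm_lt C C) => e e_gt0.
  have := cvg_real_complex real0.
  rewrite rmorph0 => /(@cvgr0Pnorm_lt C C)/(_ e e_gt0); apply: filterS => N.
  apply: le_lt_trans; rewrite rmorphB rmorphM /= !real_complex_exp_sum rmorphD /= -xE -yE.
  have abN := ler_norm_exp_sumM a b N.
  by rewrite [leRHS]ger0_norm //; exact: le_trans (normr_ge0 _) abN.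
apply: (@cvg_lim C (@norm_hausdorff C C)).
have := cvgB (V := C) (FF := eventually_filter) abM diff0; rewrite subr0.
by apply: cvg_trans; apply: near_eq_cvg; apply: nearW => N; exact: subKr.
Qed.

(** If [z] were nonzero, a real multiple [w] of it would have modulus 1/4 and satisfy [cexp w = 1].
    The tail estimate then gives [|w| < 11/8 - 1 - 1/4 + 1/8 = 1/4], a contradiction. *)
Lemma cexp_real_mul_eq1 z :
  (forall t : R, cexp (real_complex R t * z) = 1) -> z = 0.
Proof.
move=> z1; apply/eqP; apply: contraT => z_neq0.
have [x xE] : exists x, `|z| = real_complex R x.
  by apply/complex_realP; rewrite normr_real.
have x_gt0 : 0 < x by rewrite -ltcR -xE normr_gt0.
pose w : C := real_complex R (4 * x)^-1 * z.
have wE : `|w| = real_complex R 4^-1.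
  have x4_ge0 : 0 <= (4 * x)^-1 by rewrite invr_ge0; lra.
  rewrite normrM normc_real xE -rmorphM (ger0_norm x4_ge0) /=.
  by congr (real_complex R _); field; exact: lt0r_neq0.
(* The inequality [1 + x <= expR x] at [x = -1/4] yields [expR (1/4) <= 4/3], and [4/3 < 11/8]. *)
have expR_lt : expR (4^-1 : R) < 11%:R / 8%:R.
  have := expR_ge1Dx (- 4^-1 : R); rewrite expRN => h.
  have e_gt0 := expR_gt0 (4^-1 : R).
  have : (3 / 4) * expR (4^-1 : R) <= 1.
    by rewrite -ler_pdivlMr // div1r; apply: le_trans h; lra.
  by move: (expR _) => r; lra.
have w_near : \forall N \near \oo, `|1 - exp_sum w N| < real_complex R 8%:R^-1.
  have := @cvg_exp_sum w; rewrite z1 => /(@cvgrPdist_lt _ C); apply.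
  by rewrite ltcR; lra.
have r_near : \forall N \near \oo, exp_sum (4^-1 : R) N < 11%:R / 8%:R.
  by apply: (cvgr_lt (expR (4^-1 : R))) => //; exact: cvg_exp_sumR.
near \oo => N.
(* The tail estimate splits off two terms, so [N] has to be at least 2. *)
have [M NE] : exists M, N = M.+2.
  by exists N.-2; rewrite -subn2 -addn2 subnK //; near: N; exact: nbhs_infty_ge.
have : `|1 - exp_sum w N| < real_complex R 8%:R^-1 by near: N.
have : exp_sum (4^-1 : R) N < 11%:R / 8%:R by near: N.
rewrite {}NE => r_lt w_lt.
have le_r : `|exp_sum w M.+2 - 1 - w| <= real_complex R (exp_sum 4^-1 M.+2 - 1 - 4^-1).
  by rewrite !rmorphB rmorph1 /= real_complex_exp_sum -wE; exact: ler_norm_exp_sumB1.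
have wN : - w = (exp_sum w M.+2 - 1 - w) + (1 - exp_sum w M.+2) by ring.
have : `|w| < real_complex R (exp_sum 4^-1 M.+2 - 1 - 4^-1) + real_complex R 8^-1.
  by rewrite -normrN wN; apply: le_lt_trans (ler_normD _ _) _; exact: ler_ltD.
rewrite wE -rmorphD ltcR; move: (exp_sum _ _) r_lt => s; lra.
Unshelve. all: by end_near. Qed.

End ComplexExponential.

(** * Entrywise limits of matrices and limits of finite sums *)

Section MatrixLimits.
Variables (K : numFieldType) (n : nat).

Lemma cvg_mx (u : nat -> 'M[K]_n) (l : 'M[K]_n) :
  (forall i j, (fun N => u N i j) @ \oo --> l i j) -> u @ \oo --> l.
Proof.
move=> ul A [P lP PA].
suff : \forall N \near \oo, forall i j, P i j (u N i j).
  by apply: filterS => N uNP; exact: PA.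
by apply: filter_forall => i; apply: filter_forall => j; exact: (ul i j _ (lP i j)).
Qed.

(** Entrywise convergence gives convergence of the matrix series, so the limit in [mx_exp] is a
    genuine one; uniqueness is then checked entry by entry, [K] being Hausdorff. *)
Lemma mx_exp_eq (A L : 'M[K]_n) :
  (forall i j, (fun N => \sum_(k < N) (k`!%:R)^-1 * (A ^+ k) i j) @ \oo --> L i j) ->
  mx_exp A = L.
Proof.
move=> AL; pose u := series (fun k : nat => (k`!%:R)^-1 *: A ^+ k).
have uE i j : (fun N => u N i j) = fun N => \sum_(k < N) (k`!%:R)^-1 * (A ^+ k) i j.
  apply/funext => N; rewrite /u /series /= big_mkord summxE.
  by apply: eq_bigr => k _; rewrite mxE.
have uL : u @ \oo --> L by apply: cvg_mx => i j; rewrite uE; exact: AL.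
have ulim : u @ \oo --> mx_exp A by apply: (cvgP L); exact: uL.
apply/matrixP => i j.
have [uLij ulimij] : (fun N => u N i j) @ \oo --> L i j /\
    (fun N => u N i j) @ \oo --> mx_exp A i j.
  split; [exact: (cvg_comp _ _ uL (@coord_continuous K n n i j L))|].
  exact: (cvg_comp _ _ ulim (@coord_continuous K n n i j (mx_exp A))).
have unique := @cvg_lim K (@norm_hausdorff K K).
by rewrite -(unique _ _ _ _ _ ulimij) -(unique _ _ _ _ _ uLij).
Qed.

End MatrixLimits.

Lemma cvg_finsum (K : numFieldType) (I : Type) (r : seq I) (u : I -> nat -> K) (l : I -> K) :
  (forall i, u i @ \oo --> l i) ->
  (fun N => \sum_(i <- r) u i N) @ \oo --> \sum_(i <- r) l i.
Proof.
move=> ul; elim: r => [|i r IH].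
  rewrite big_nil [X in X @ _](_ : _ = fun=> 0); first exact: cvg_cst.
  by apply/funext => N; rewrite big_nil.
rewrite big_cons [X in X @ _](_ : _ = fun N => u i N + \sum_(j <- r) u j N).
  by apply: cvgD; [exact: ul|exact: IH].
by apply/funext => N; rewrite big_cons.
Qed.

(** * Exponentials of matrices diagonalizable over the complex numbers *)

Section DiagonalizableExponential.
Variables (R : realType) (F : real_or_complex).
Local Notation K := (ground_field R F).
Local Notation C := (complex_field R).

Definition embed (x : K) : C := to_complex x.

Lemma embed_is_additive : additive embed.
Proof. by rewrite /embed; case: F => // x y; exact: rmorphB. Qed.

Lemma embed_is_multiplicative : multiplicative embed.
Proof. by rewrite /embed; case: F; split => // x y; exact: rmorphM. Qed.

HB.instance Definition _ := GRing.isAdditive.Build K C embed embed_is_additive.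
HB.instance Definition _ :=
  GRing.isMultiplicative.Build K C embed embed_is_multiplicative.

Lemma real_embed (t : R) : exists2 s : K, s \is Num.real & embed s = real_complex R t.
Proof.
rewrite /embed; case: F; first by exists t => //; exact: num_real.
by exists (real_complex R t) => //; apply/complex_realP; exists t.
Qed.

(** For real [K], taking real parts is continuous and fixes the sequence, so by uniqueness the limit
    equals its own real part. *)
Lemma embed_limit (u : nat -> K) (l : C) :
  (fun k => embed (u k)) @ \oo --> l -> exists2 m : K, embed m = l & u @ \oo --> m.
Proof.
rewrite /embed /to_complex; case: F u => /= u ul; last by exists l.
exists (complex.Re l : R); last exact: (cvg_Re ul).
have unique := @cvg_lim C (@norm_hausdorff C C).
have := cvg_real_complex (cvg_Re ul) => /= ulR.
by rewrite -(unique _ _ _ _ _ ulR) -(unique _ _ _ _ _ ul).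
Qed.

(** Conjugation by [P] turns powers of [A] into powers of [d], so the partial sums converge over
    [C]. The exponential itself is formed over [K], which calls for a descent of the limit. *)
Lemma mx_exp_diag n (P : 'M[C]_n) (d : 'rV[C]_n) (A : 'M[K]_n) :
  P \in unitmx -> P *m map_mx embed A = diag_mx d *m P ->
  P *m map_mx embed (mx_exp A) = diag_mx (map_mx (@cexp R) d) *m P.
Proof.
move=> Pu PA; pose L := invmx P *m diag_mx (map_mx (@cexp R) d) *m P.
have powE k : map_mx embed (A ^+ k) = invmx P *m diag_mx (map_mx (fun x => x ^+ k) d) *m P.
  suff PAk : P *m map_mx embed (A ^+ k) = diag_mx (map_mx (fun x => x ^+ k) d) *m P.
    by rewrite -mulmxA -PAk mulKmx.
  elim: k => [|k IH].
    rewrite !expr0 map_mx1 mulmx1 [X in diag_mx X](_ : _ = const_mx 1).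
      by rewrite diag_const_mx mul1mx.
    by apply/rowP => i; rewrite !mxE expr0.
  rewrite exprS map_mxM mulmxA PA -mulmxA IH mulmxA; congr (_ *m _).
  by rewrite mulmx_diag; congr diag_mx; apply/rowP => i; rewrite !mxE exprS.
have cvgL i j : (fun N => embed (\sum_(k < N) (k`!%:R)^-1 * (A ^+ k) i j)) @ \oo --> L i j.
  have LE (f : C -> C) : (invmx P *m diag_mx (map_mx f d) *m P) i j =
      \sum_l invmx P i l * f (d 0 l) * P l j.
    by rewrite mxE; apply: eq_bigr => l _; rewrite mul_mx_diag !mxE.
  rewrite /L LE [X in X @ _](_ : _ =
    fun N => \sum_l invmx P i l * exp_sum (d 0 l) N * P l j); last first.
    apply/funext => N; rewrite rmorph_sum /=.
    under eq_bigr => k _.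
      rewrite rmorphM fmorphV rmorph_nat /=.
      have /matrixP/(_ i j) := powE k; rewrite mxE LE => ->.
      rewrite mulr_sumr; over.
    rewrite exchange_big /=; apply: eq_bigr => l _.
    rewrite mulr_sumr mulr_suml; apply: eq_bigr => k _.
    by rewrite !mulrA [_^-1 * _]mulrC.
  apply: (@cvg_finsum C) => l; apply: (@cvgMr_tmp C); apply: (@cvgMl_tmp C).
  exact: cvg_exp_sum.
(* Each entry of [L] is a limit of elements of [K], hence comes from [K]. *)
have [M ME uM] : exists2 M : 'M[K]_n, map_mx embed M = L &
    forall i j, (fun N => \sum_(k < N) (k`!%:R)^-1 * (A ^+ k) i j) @ \oo --> M i j.
  have /choice[M MP] : forall ij : 'I_n * 'I_n, exists m : K, embed m = L ij.1 ij.2 /\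
      (fun N => \sum_(k < N) (k`!%:R)^-1 * (A ^+ k) ij.1 ij.2) @ \oo --> m.
    move=> [i j]; have [m mE um] := embed_limit (cvgL i j).
    by exists m; split; [exact: mE|exact: um].
  exists (\matrix_(i, j) M (i, j)).
    by apply/matrixP => i j; rewrite [LHS]mxE [X in embed X]mxE; case: (MP (i, j)).
  by move=> i j; rewrite mxE; case: (MP (i, j)).
by rewrite (mx_exp_eq uM) ME /L -mulmxA mulKVmx.
Qed.

End DiagonalizableExponential.

(** * Dickson's lemma for exponent vectors *)

Section Dickson.

(** Each new index is chosen beyond the previous one and minimizes [u] over all indices still
    available, so the selected values cannot decrease. *)
Lemma nondecreasing_subsequence (u : nat -> nat) :
  exists2 f : nat -> nat, {homo f : i j / (i < j)%N} & {homo u \o f : i j / (i <= j)%N}.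
Proof.
have /choice[k kP] N : exists k, (N <= k)%N /\ forall j, (N <= j)%N -> (u k <= u j)%N.
  have exu : exists m, `[< exists2 k, (N <= k)%N & u k = m >].
    by exists (u N); apply/asboolP; exists N.
  have [m /asboolP[k Nk <-] m_min] := ex_minnP exu.
  by exists k; split=> // j Nj; apply: m_min; apply/asboolP; exists j.
pose f i := iter i (fun j => k j.+1) (k 0%N).
have fS i : (f i < f i.+1)%N by have [] := kP (f i).+1.
exists f; first exact: (homo_ltn ltn_trans).
apply: homo_leq leq_trans _ => // i /=.
have f_min : forall j, (f i <= j)%N -> (u (f i) <= u j)%N.
  case: i => [|i] j; first by have [_ +] := kP 0%N; move=> + _; apply.
  have [fi umin] := kP (f i).+1 => /(leq_trans fi); exact: umin.
exact/f_min/ltnW.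
Qed.

(** Subsequences are extracted one coordinate at a time; monotonicity already obtained survives
    further extraction. *)
Lemma mnm_nondecreasing_subsequence n (u : nat -> multinom n) :
  exists2 f : nat -> nat, {homo f : i j / (i < j)%N} &
    forall j, (u (f 0%N) j <= u (f 1%N) j)%N.
Proof.
suff [f f_lt uf] : exists2 f : nat -> nat, {homo f : i j / (i < j)%N} &
    forall j, j \in enum 'I_n -> {homo (fun i => u (f i) j) : i i' / (i <= i')%N}.
  by exists f => // j; apply: uf; rewrite ?mem_enum.
elim: (enum 'I_n) => [|j s [f f_lt uf]]; first by exists id.
have [g g_lt ug] := nondecreasing_subsequence (fun i => u (f i) j).
exists (f \o g) => [i i' ii'|j']; first exact/f_lt/g_lt.
rewrite inE => /predU1P[->|j's] // i i' ii'; apply: uf => //.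
by move: ii'; rewrite leq_eqVlt => /predU1P[->//|/g_lt/ltnW].
Qed.

(** Otherwise one could keep choosing elements of [S] that lie above none of the earlier choices,
    and such a sequence has no two comparable terms in increasing order. *)
Lemma dickson n (S : set (multinom n)) :
  exists2 s : seq (multinom n), (forall m, m \in s -> S m) &
    forall m, S m -> exists2 g, g \in s & lem g m.
Proof.
apply: contrapT => noS.
(* The choice function is total; on lists that leave [S] it takes the dummy value [mnm0]. *)
have /choice[next nextP] (s : seq (multinom n)) : exists m, (forall m, m \in s -> S m) ->
    S m /\ forall g, g \in s -> ~ lem g m.
  have [sS|] := pselect (forall m, m \in s -> S m); last by exists (@mnm0 n).
  apply: contrapT => no_next; apply: noS; exists s => // m Sm.
  apply: contrapT => no_g; apply: no_next; exists m => _; split=> // g gs gm.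
  by apply: no_g; exists g.
pose l := fix l k := if k is k'.+1 then next (l k') :: l k' else [::].
have lS k : forall m, m \in l k -> S m.
  elim: k => // k IH m; rewrite inE => /predU1P[->|/IH//].
  by have [] := nextP _ IH.
have l_mem i j : (i < j)%N -> next (l i) \in l j.
  elim: j => // j IH; rewrite ltnS leq_eqVlt => /predU1P[->|/IH lij]; rewrite inE ?eqxx //.
  by rewrite lij orbT.
have [f f_lt uf] := mnm_nondecreasing_subsequence (fun k => next (l k)).
have [_ no_le] := nextP _ (lS (f 1%N)).
by apply: no_le (l_mem _ _ (f_lt 0%N 1%N _)) _ => //; exact/mnm_lepP.
Qed.

End Dickson.

(** * Linear changes of variables and the Lie derivative on polynomials *)

Section LinearSubstitution.
Variables (L : numFieldType) (n : nat).
Local Notation Lx := (mpoly n L).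
Implicit Types (B P Q : 'M[L]_n) (p q phi : Lx).

Definition lin_form P (i : 'I_n) : Lx := \sum_j P i j *: mpolyX L (mnm1 j).

(** The polynomial form of [x |-> phi (P x)]; being a pullback, it reverses the order of
    composition. *)
Definition lin_subst P phi : Lx := comp_mpoly [tuple lin_form P i | i < n] phi.

Lemma linear_vfE B i : linear_vf B i 0 = lin_form B i.
Proof. by rewrite mxE; apply: eq_bigr => j _; rewrite !mxE mul_mpolyC. Qed.

Lemma lin_subst_is_additive P : additive (lin_subst P).
Proof. exact: raddfB. Qed.

Lemma lin_subst_is_multiplicative P : multiplicative (lin_subst P).
Proof. by split; [exact: rmorphM|exact: rmorph1]. Qed.

Lemma lin_subst_is_scalable P : scalable (lin_subst P).
Proof. by move=> c p; exact: comp_mpolyZ. Qed.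

HB.instance Definition _ P :=
  GRing.isAdditive.Build Lx Lx (lin_subst P) (lin_subst_is_additive P).
HB.instance Definition _ P :=
  GRing.isMultiplicative.Build Lx Lx (lin_subst P) (lin_subst_is_multiplicative P).
HB.instance Definition _ P :=
  GRing.isScalable.Build L Lx Lx *:%R (lin_subst P) (lin_subst_is_scalable P).

Lemma lin_substE P phi :
  lin_subst P phi = \sum_(m <- msupp phi) mcoeff m phi *: \prod_i lin_form P i ^+ m i.
Proof.
rewrite /lin_subst comp_mpolyEX; apply: eq_bigr => m _; rewrite comp_mpolyX.
by congr (_ *: _); apply: eq_bigr => i _; rewrite tnth_mktuple.
Qed.

Lemma lin_substX P m : lin_subst P (mpolyX L m) = \prod_i lin_form P i ^+ m i.
Proof. by rewrite /lin_subst comp_mpolyX; apply: eq_bigr => i _; rewrite tnth_mktuple. Qed.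

Lemma lin_substU P i : lin_subst P (mpolyX L (mnm1 i)) = lin_form P i.
Proof. by rewrite /lin_subst comp_mpolyXU -tnth_nth tnth_mktuple. Qed.

Lemma lin_subst_lin_form P Q i : lin_subst Q (lin_form P i) = lin_form (P *m Q) i.
Proof.
rewrite /lin_form raddf_sum /=.
under eq_bigr => j _ do rewrite linearZ /= lin_substU /lin_form scaler_sumr.
rewrite exchange_big; apply: eq_bigr => k _ /=; rewrite mxE scaler_suml.
by apply: eq_bigr => j _; rewrite scalerA.
Qed.

Lemma lin_substM P Q phi : lin_subst Q (lin_subst P phi) = lin_subst (P *m Q) phi.
Proof.
rewrite [lin_subst P phi]lin_substE [RHS]lin_substE raddf_sum /=; apply: eq_bigr => m _.
rewrite linearZ rmorph_prod /=; congr (_ *: _); apply: eq_bigr => i _.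
by rewrite rmorphXn /= lin_subst_lin_form.
Qed.

Lemma lin_form1 i : lin_form 1%:M i = mpolyX L (mnm1 i).
Proof.
rewrite /lin_form (bigD1 i) //= mxE eqxx scale1r big1 ?addr0 // => j ji.
by rewrite mxE eq_sym (negbTE ji) scale0r.
Qed.

Lemma lin_subst1 phi : lin_subst 1%:M phi = phi.
Proof.
rewrite /lin_subst -[RHS]comp_mpoly_id; congr (comp_mpoly _ _).
by apply: eq_from_tnth => i; rewrite !tnth_mktuple lin_form1.
Qed.

Lemma meval_lin_subst P phi (x : 'cV[L]_n) :
  meval (fun i => x i 0) (lin_subst P phi) = meval (fun i => (P *m x) i 0) phi.
Proof.
rewrite comp_mpoly_meval; apply: meval_eq => i.
rewrite tnth_mktuple /lin_form raddf_sum mxE /=; apply: eq_bigr => j _.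
by rewrite mevalZ mevalXU.
Qed.

Lemma lie_derivative_is_additive B : additive (lie_derivative B).
Proof.
move=> p q; rewrite /lie_derivative -sumrB; apply: eq_bigr => j _.
by rewrite mderivB mulrBl.
Qed.

Lemma lie_derivative_is_scalable B : scalable (lie_derivative B).
Proof.
move=> c p; rewrite /lie_derivative scaler_sumr; apply: eq_bigr => j _.
by rewrite mderivZ scalerAl.
Qed.

HB.instance Definition _ B :=
  GRing.isAdditive.Build Lx Lx (lie_derivative B) (lie_derivative_is_additive B).
HB.instance Definition _ B :=
  GRing.isScalable.Build L Lx Lx *:%R (lie_derivative B) (lie_derivative_is_scalable B).

Lemma lie_derivativeM B p q :
  lie_derivative B (p * q) = lie_derivative B p * q + p * lie_derivative B q.
Proof.
rewrite /lie_derivative mulr_suml mulr_sumr -big_split /=; apply: eq_bigr => j _.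
by rewrite mderivM mulrDl mulrAC mulrA.
Qed.

Lemma lie_derivative1 B : lie_derivative B 1 = 0.
Proof.
by rewrite /lie_derivative big1 // => j _; rewrite -mpolyC1 mderivC mul0r.
Qed.

Lemma mderiv_lin_form B i j :
  mderiv j (lin_form B i) = mpolyC n (B i j).
Proof.
rewrite /lin_form raddf_sum (bigD1 j) //= big1 => [|l lj]; rewrite mderivZ mderivX mnm1E.
  rewrite eqxx scale1r (_ : mnm_sub _ _ = @mnm0 n) ?mpolyX0 ?addr0; last first.
    by apply/mnmP => k; rewrite mnmBE subnn mnm0E.
  by rewrite -mul_mpolyC mulr1.
by rewrite (negbTE lj) scale0r scaler0.
Qed.

(** The differential of [x |-> P x] is [P], here evaluated at the vector [B x]. *)
Lemma lie_derivative_lin_form B P i : lie_derivative B (lin_form P i) = lin_form (P *m B) i.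
Proof.
transitivity (\sum_j P i j *: lin_form B j).
  by apply: eq_bigr => j _; rewrite linear_vfE mderiv_lin_form mul_mpolyC.
rewrite -lin_subst_lin_form [lin_form P i]/lin_form raddf_sum; apply: eq_bigr => j _.
by rewrite /= linearZ /= lin_substU.
Qed.

Lemma invariants0 B : invariants B 0.
Proof. exact: raddf0. Qed.

Lemma invariantsD B p q : invariants B p -> invariants B q -> invariants B (p + q).
Proof. by rewrite /invariants /= raddfD /= => -> ->; rewrite addr0. Qed.

Lemma invariantsM B p q : invariants B p -> invariants B q -> invariants B (p * q).
Proof. by rewrite /invariants /= lie_derivativeM => -> ->; rewrite mul0r mulr0 addr0. Qed.

Lemma invariantsZ B c p : invariants B p -> invariants B (c *: p).
Proof. by rewrite /invariants /= linearZ /= => ->; rewrite scaler0. Qed.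

Lemma diagonal_operator_mcoeff (T : {linear Lx -> Lx}) (w : multinom n -> L) phi m :
  (forall k, T (mpolyX L k) = w k *: mpolyX L k) -> mcoeff m (T phi) = w m * mcoeff m phi.
Proof.
move=> TX; rewrite {1}(mpolyE phi) raddf_sum raddf_sum /=.
rewrite [in RHS](mpolyE phi) raddf_sum mulr_sumr /=; apply: eq_bigr => k _.
rewrite linearZ /= TX !mcoeffZ mcoeffX; case: eqP => [->|_]; last by rewrite !mulr0.
by rewrite mulrCA.
Qed.

End LinearSubstitution.

(** * Finite generation as an induction principle *)

Section Generation.

(** The second clause replaces explicit expressions by induction: a property stable under the
    algebra operations passes from [s] to [A]. The descent below uses it with a property of two
    projections at once. *)
Definition generates_subalgebra (K : numFieldType) n (s : seq (mpoly n K))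
    (A : set (mpoly n K)) : Prop :=
  (forall g, g \in s -> A g) /\
  forall N : set (mpoly n K), (forall c, N (mpolyC n c)) ->
    (forall u v, N u -> N v -> N (u + v)) -> (forall u v, N u -> N v -> N (u * v)) ->
    (forall g, g \in s -> N g) -> A `<=` N.

Definition generates_submodule (S : nzRingType) (V : lmodType S) (A : set S)
    (s : seq V) (M : set V) : Prop :=
  (forall g, g \in s -> M g) /\
  forall N : set V, N 0 -> (forall u v, N u -> N v -> N (u + v)) ->
    (forall a u, A a -> N u -> N (a *: u)) -> (forall g, g \in s -> N g) -> M `<=` N.

Lemma generates_fin_gen_subalgebra (K : numFieldType) n (s : seq (mpoly n K)) B :
  generates_subalgebra s (invariants B) -> fin_gen_subalgebra (invariants B).
Proof.
move=> [sB gen]; split; first exact: lie_derivative1.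
- by move=> a u v Bu Bv; apply: invariantsD => //; exact: invariantsZ.
- by move=> u v; exact: invariantsM.
exists (size s), (in_tuple s); split; first by move=> i; apply/sB/mem_tnth.
(* The induction runs over the image of the substitution of [s] into polynomials in [size s]
   variables. *)
apply: gen => [c|u v [p ->] [q ->]|u v [p ->] [q ->]|g].
- by exists (mpolyC _ c); rewrite comp_mpolyC.
- by exists (p + q); rewrite raddfD.
- by exists (p * q); rewrite rmorphM.
rewrite -[g \in s]/(g \in in_tuple s) => /tnthP[i ->]; exists (mpolyX K (mnm1 i)).
by rewrite comp_mpolyXU -tnth_nth.
Qed.

Lemma generates_fin_gen_submodule (K : numFieldType) n (V : lmodType (mpoly n K))
    (B : 'M[K]_n) (s : seq V) (M : set V) :
  M 0 -> (forall u v, M u -> M v -> M (u + v)) ->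
  (forall a u, invariants B a -> M u -> M (a *: u)) ->
  generates_submodule (invariants B) s M -> fin_gen_submodule (invariants B) M.
Proof.
move=> M0 MD MZ [sM gen]; split=> //.
exists (size s), (tnth (in_tuple s)); split; first by move=> i; apply/sM/mem_tnth.
apply: gen => [|u v [b [Bb ->]] [c [Bc ->]]|a u Ba [c [Bc ->]]|g].
- exists (fun=> 0); split=> [_|]; first exact: invariants0.
  by rewrite big1 // => i _; rewrite scale0r.
- exists (fun i => b i + c i); split=> [i|]; first exact: invariantsD.
  by rewrite -big_split; apply: eq_bigr => i _; rewrite scalerDl.
- exists (fun i => a * c i); split=> [i|]; first exact: invariantsM.
  by rewrite scaler_sumr; apply: eq_bigr => i _; rewrite scalerA.
rewrite -[g \in s]/(g \in in_tuple s) => /tnthP[i ->].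
exists (fun j => (j == i)%:R); split=> [j|].
  by case: eqP => _; [exact: lie_derivative1|exact: invariants0].
rewrite (bigD1 i) //= eqxx scale1r big1 ?addr0 // => j /negbTE ->.
by rewrite scale0r.
Qed.

End Generation.

(** * Coordinates [y = P x] diagonalizing [B], and semi-invariants *)

Section EigenCoordinates.
Variables (L : numFieldType) (n : nat) (P : 'M[L]_n).
Hypothesis Punit : P \in unitmx.
Local Notation Lx := (mpoly n L).
Implicit Types (B E : 'M[L]_n) (d e : 'rV[L]_n) (m : multinom n) (phi psi : Lx).

Definition weight d m : L := \sum_i d 0 i *+ m i.

Definition eigen_monomial m : Lx := lin_subst P (mpolyX L m).

(** Substituting [invmx P] rewrites [phi] in the coordinates [y], so this is the coefficient of
    [y^m]. *)
Definition eigen_coef m phi : L := mcoeff m (lin_subst (invmx P) phi).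

Lemma weightD d m1 m2 : weight d (mnm_add m1 m2) = weight d m1 + weight d m2.
Proof. by rewrite /weight -big_split; apply: eq_bigr => i _; rewrite mnmDE mulrnDr. Qed.

Lemma eigen_monomialD m1 m2 :
  eigen_monomial (mnm_add m1 m2) = eigen_monomial m1 * eigen_monomial m2.
Proof. by rewrite /eigen_monomial mpolyXD rmorphM. Qed.

Lemma lin_subst_invmxK : cancel (lin_subst (invmx P)) (lin_subst P).
Proof. by move=> phi; rewrite lin_substM mulVmx // lin_subst1. Qed.

Lemma lin_substK_invmx : cancel (lin_subst P) (lin_subst (invmx P)).
Proof. by move=> phi; rewrite lin_substM mulmxV // lin_subst1. Qed.

Lemma eigen_coef_inj phi psi :
  (forall m, eigen_coef m phi = eigen_coef m psi) -> phi = psi.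
Proof. by move=> eq_coef; apply: (can_inj lin_subst_invmxK); apply/mpolyP. Qed.

Lemma eigen_expansion phi :
  phi = \sum_(m <- msupp (lin_subst (invmx P) phi)) eigen_coef m phi *: eigen_monomial m.
Proof.
rewrite -{1}(lin_subst_invmxK phi) {1}(mpolyE (lin_subst (invmx P) phi)) raddf_sum /=.
by apply: eq_bigr => m _; rewrite linearZ.
Qed.

Section LieDerivative.
Variables (B : 'M[L]_n) (d : 'rV[L]_n).
Hypothesis PB : P *m B = diag_mx d *m P.

(** The rows of [P] are left eigenvectors of [B], so each [y_i] is an eigenvector of the derivation,
    and by the Leibniz rule eigenvalues add under products. *)
Lemma lie_derivative_eigen_monomial m :
  lie_derivative B (eigen_monomial m) = weight d m *: eigen_monomial m.
Proof.
pose eigen u c := lie_derivative B u = c *: u.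
have eigenM u v b c : eigen u b -> eigen v c -> eigen (u * v) (b + c).
  by rewrite /eigen lie_derivativeM => -> ->; rewrite -scalerAl -scalerAr -scalerDl.
have eigen1 : eigen 1 0 by rewrite /eigen lie_derivative1 scale0r.
rewrite /eigen_monomial lin_substX; apply: (big_rec2 eigen) => // i c u _ eig_u.
apply: (eigenM) eig_u; elim: (m i) => [|k IH]; first by rewrite mulr0n.
rewrite exprS mulrS; apply: eigenM IH.
rewrite /eigen lie_derivative_lin_form PB /lin_form scaler_sumr.
by apply: eq_bigr => j _; rewrite mul_diag_mx mxE scalerA.
Qed.

Lemma eigen_coef_lie_derivative m phi :
  eigen_coef m (lie_derivative B phi) = weight d m * eigen_coef m phi.
Proof.
rewrite -{1}(lin_subst_invmxK phi).
pose T := lin_subst (invmx P) \o lie_derivative B \o lin_subst P.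
apply: (@diagonal_operator_mcoeff L n T) => k /=.
by rewrite lie_derivative_eigen_monomial linearZ /= lin_substK_invmx.
Qed.

(** In the coordinates [y] the defining equation says that [weight d m - chi] annihilates the
    coefficient of each [y^m]. *)
Lemma semi_invariantsP chi phi :
  semi_invariants chi B phi <-> forall m, eigen_coef m phi != 0 -> weight d m = chi.
Proof.
split=> [phiP m m_neq0|phiP].
  apply: (mulIf m_neq0); rewrite -eigen_coef_lie_derivative phiP.
  by rewrite /eigen_coef linearZ /= mcoeffZ.
apply: eigen_coef_inj => m; rewrite eigen_coef_lie_derivative.
rewrite {2}/eigen_coef linearZ /= mcoeffZ -/(eigen_coef _ _).
by have [->|/phiP ->//] := eqVneq (eigen_coef m phi) 0; rewrite !mulr0.
Qed.

Lemma eigen_monomial_semi_invariant m : semi_invariants (weight d m) B (eigen_monomial m).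
Proof. exact: lie_derivative_eigen_monomial. Qed.

Lemma semi_invariants_closed (N : set Lx) chi :
  N 0 -> (forall u v, N u -> N v -> N (u + v)) -> (forall c u, N u -> N (c *: u)) ->
  (forall m, weight d m = chi -> N (eigen_monomial m)) -> semi_invariants chi B `<=` N.
Proof.
move=> N0 ND NZ Nm phi /semi_invariantsP phiP; rewrite (eigen_expansion phi).
rewrite big_seq; apply: (big_ind N) => // m; rewrite mcoeff_msupp => m_neq0.
by apply/NZ/Nm/phiP.
Qed.

Lemma invariants_semi phi : invariants B phi <-> semi_invariants 0 B phi.
Proof. by rewrite /semi_invariants /= scale0r. Qed.

(** If [g <= m] both have weight [chi], then [y^m = y^(m - g) y^g] with an invariant first factor.
    Dickson's lemma makes finitely many [g] suffice. *)
Lemma semi_invariants_generated chi :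
  exists s : seq Lx, generates_submodule (V := Lx^o) (invariants B) s (semi_invariants chi B).
Proof.
have [s s_chi s_le] := dickson [set m | weight d m = chi].
exists (map eigen_monomial s); split.
  by move=> _ /mapP[m /s_chi <- ->]; exact: eigen_monomial_semi_invariant.
move=> N N0 ND NI Ns; have NZ (c : L) (u : Lx) : N u -> N (c *: u).
  move=> Nu; rewrite -mul_mpolyC; apply: (NI (mpolyC n c)) => //.
  by rewrite -[mpolyC _ _]mulr1 mul_mpolyC; apply/invariantsZ/lie_derivative1.
apply: semi_invariants_closed => // m m_chi; have [g gs gm] := s_le m m_chi.
rewrite -(submK gm) eigen_monomialD; apply: (NI (eigen_monomial (mnm_sub m g))).
  apply/invariants_semi; suff <- : weight d (mnm_sub m g) = 0.
    exact: eigen_monomial_semi_invariant.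
  by apply: (@addIr _ (weight d g)); rewrite -weightD submK // add0r m_chi s_chi.
exact/Ns/map_f.
Qed.

(** Induction on the degree of a weight-zero exponent: subtracting a minimal one keeps the weight
    zero. *)
Lemma invariants_generated :
  exists s : seq Lx, generates_subalgebra s (invariants B).
Proof.
(* Excluding the zero exponent makes every subtraction lower the degree strictly. *)
have [s s0 s_le] := dickson [set m | weight d m = 0 /\ m != @mnm0 n].
exists (map eigen_monomial s); split.
  move=> _ /mapP[m /s0[m0 _] ->]; apply/invariants_semi; rewrite -m0.
  exact: eigen_monomial_semi_invariant.
move=> N NC ND NM Ns phi /invariants_semi; move: phi; apply: semi_invariants_closed => //.
- by rewrite -(mpolyC0 n L); exact: NC.
- by move=> c u Nu; rewrite -mul_mpolyC; exact: NM.
move=> m; have [k] := ubnP (mdeg m); elim: k m => // k IH m m_lt m0.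
have [->|m_neq0] := eqVneq m (@mnm0 n).
  by rewrite /eigen_monomial mpolyX0 rmorph1 -mpolyC1; exact: NC.
have [g gs gm] := s_le m (conj m0 m_neq0); have [g0 g_neq0] := s0 g gs.
have mE := submK gm.
rewrite -mE eigen_monomialD; apply: NM; last exact/Ns/map_f.
apply: IH.
  rewrite -mE mdegD ltnS in m_lt; apply: leq_trans m_lt.
  by rewrite -addn1 leq_add2l lt0n mdeg_eq0.
by apply: (@addIr _ (weight d g)); rewrite -weightD mE g0 m0 addr0.
Qed.

End LieDerivative.

(** In the coordinates [y] the matrix [E] scales [y_i] by [e 0 i], and hence [y^m] by the product of
    the powers. *)
Lemma eigen_coef_lin_subst E e m phi : P *m E = diag_mx e *m P ->
  eigen_coef m (lin_subst E phi) = (\prod_i e 0 i ^+ m i) * eigen_coef m phi.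
Proof.
move=> PE; rewrite -{1}(lin_subst_invmxK phi).
pose T := lin_subst (invmx P) \o lin_subst E \o lin_subst P.
apply: (@diagonal_operator_mcoeff L n T (fun k => \prod_i e 0 i ^+ k i)) => k /=.
rewrite [lin_subst E _]lin_substM PE -!lin_substM lin_substK_invmx lin_substX.
rewrite mpolyXE_id -scaler_prod; apply: eq_bigr => i _; rewrite -exprZn; congr (_ ^+ _).
rewrite -[in RHS]lin_form1 -[diag_mx e]mulmx1 /lin_form scaler_sumr.
by apply: eq_bigr => j _; rewrite mul_diag_mx mxE scalerA.
Qed.

End EigenCoordinates.

(** * Polynomials vanishing at every point *)

Section PolynomialIdentity.

(** Base-[N] digits are unique: reduction modulo [N] gives the lowest one, division by [N] shifts
    the others. *)
Lemma base_expansion_inj N n (f g : nat -> nat) :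
  (forall i, (f i < N)%N) -> (forall i, (g i < N)%N) ->
  (\sum_(i < n) f i * N ^ i = \sum_(i < n) g i * N ^ i)%N ->
  forall i, (i < n)%N -> f i = g i.
Proof.
elim: n f g => // n IH f g fN gN; rewrite !big_ord_recl !expn0 !muln1.
have shift (h : nat -> nat) : (\sum_(i < n) h (lift ord0 i) * N ^ lift ord0 i =
    (\sum_(i < n) h i.+1 * N ^ i) * N)%N.
  by rewrite big_distrl; apply: eq_bigr => i _; rewrite /= expnSr mulnA.
rewrite !shift /= => fg.
have fg0 : f 0%N = g 0%N.
  by have := congr1 (modn^~ N) fg; rewrite ![(_ + _ * N)%N]addnC !modnMDl !modn_small.
move: fg; rewrite fg0 => /addnI /eqP; rewrite eqn_pmul2r; last exact: leq_ltn_trans (fN 0%N).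
move=> /eqP fgS [|i] // i_lt.
exact: (IH (f \o succn) (g \o succn) (fun j => fN j.+1) (fun j => gN j.+1) fgS).
Qed.

(* Kronecker substitution x_i = t ^ (N ^ i) with N above the degree keeps the
   monomials of p apart, which reduces the claim to univariate polynomials. *)
Lemma meval_eq0 (K : numFieldType) n (p : mpoly n K) : (forall v, meval v p = 0) -> p = 0.
Proof.
move=> p0; apply/mpolyP => m; rewrite mcoeff0; apply/eqP; apply: contraT => pm_neq0.
pose N := msize p; pose code (m : multinom n) := (\sum_(i < n) m i * N ^ i)%N.
have code_inj m1 m2 : m1 \in msupp p -> m2 \in msupp p -> code m1 = code m2 -> m1 = m2.
  have ltN k i : k \in msupp p -> (k i < N)%N.
    move=> /msize_mdeg_lt; apply: leq_ltn_trans.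
    by rewrite mdegE (bigD1 i) //= leq_addr.
  move=> p1 p2 eq_code; apply/mnmP => i.
  (* Digits are indexed by all naturals, so exponents are padded with zeros. *)
  pose ext (k : multinom n) j := if insub j is Some j' then k j' else 0%N.
  have extE (k : multinom n) (j : 'I_n) : ext k j = k j by rewrite /ext valK.
  have ext_lt k j : k \in msupp p -> (ext k j < N)%N.
    rewrite /ext => pk; case: insubP => [j' _ _|_]; first exact: ltN.
    exact: leq_ltn_trans (ltN k i pk).
  rewrite -!extE; apply: (@base_expansion_inj N n (ext m1) (ext m2)) => //.
  - by move=> j; exact: ext_lt.
  - by move=> j; exact: ext_lt.
  - under eq_bigr do rewrite extE; under [RHS]eq_bigr do rewrite extE.
    exact: eq_code.
pose q : {poly K} := \sum_(k <- msupp p) mcoeff k p *: 'X^(code k).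
have q_eval t : q.[t] = 0.
  rewrite -(p0 (fun i => t ^+ (N ^ i))) mevalE horner_sum; apply: eq_bigr => k _.
  rewrite hornerZ hornerXn /code -prodrXr; congr (_ * _).
  by apply: eq_bigr => i _; rewrite mulnC exprM.
have q0 : q = 0.
  apply/eqP; apply: contraT => q_neq0.
  (* A nonzero [q] has fewer than [size q] roots, yet it vanishes at [size q] naturals, distinct in
     characteristic 0. *)
  have := max_poly_roots q_neq0 (rs := [seq i%:R | i <- iota 0 (size q)]).
  rewrite size_map size_iota ltnn; apply.
    by apply/allP => t _; rewrite rootE q_eval.
  by rewrite map_inj_uniq ?iota_uniq //; exact: mulrIn (oner_neq0 K).
have := congr1 (fun r : {poly K} => r`_(code m)) q0; rewrite coef0 coef_sum.
have pm : m \in msupp p by rewrite mcoeff_msupp.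
rewrite (bigD1_seq m) ?msupp_uniq //= coefZ coefXn eqxx mulr1.
rewrite big_seq_cond big1 ?addr0 => [/eqP|k /andP[pk km]]; first by rewrite (negbTE pm_neq0).
rewrite coefZ coefXn; case: eqP => [/esym/(code_inj _ _ pk pm) kE|_]; last by rewrite mulr0.
by rewrite kE eqxx in km.
Qed.

End PolynomialIdentity.

(** One shape for both modules: the 1 by 1 matrix [chi] gives the semi-invariants, and [A = B] gives
    the centralizer. *)
Definition twisted_invariants (F : numFieldType) n k (A : 'M[F]_k) (B : 'M[F]_n) :
    set 'cV[mpoly n F]_k :=
  [set w | forall i, lie_derivative B (w i 0) = \sum_j A i j *: w j 0].

(** * Descent of generators from [L] to the subfield [K] *)

Section Descent.
Variables (K L : numFieldType) (iota : {rmorphism K -> L}) (n : nat).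
Local Notation Kx := (mpoly n K).
Local Notation Lx := (mpoly n L).
Implicit Types (B : 'M[K]_n) (p phi : Kx) (q u v : Lx).

Lemma map_lin_form B i : map_mpoly iota (lin_form B i) = lin_form (map_mx iota B) i.
Proof.
rewrite /lin_form raddf_sum; apply: eq_bigr => j _ /=.
by rewrite map_mpolyZ map_mpolyX mxE.
Qed.

Lemma map_lin_subst B phi :
  map_mpoly iota (lin_subst B phi) = lin_subst (map_mx iota B) (map_mpoly iota phi).
Proof.
rewrite /lin_subst map_mpoly_comp; last exact: fmorph_inj.
congr (comp_mpoly _ _); apply: eq_from_tnth => i.
by rewrite tnth_map !tnth_mktuple map_lin_form.
Qed.

Lemma mderiv_map_mpoly (f : {additive L -> K}) i q :
  mderiv i (map_mpoly f q) = map_mpoly f (mderiv i q).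
Proof.
by apply/mpolyP => m; rewrite !(mcoeff_map_mpoly, mcoeff_mderiv) raddfMn.
Qed.

Lemma lie_derivative_map_rmorphism B phi :
  lie_derivative (map_mx iota B) (map_mpoly iota phi) = map_mpoly iota (lie_derivative B phi).
Proof.
rewrite /lie_derivative raddf_sum /=; apply: eq_bigr => j _.
rewrite rmorphM /= !linear_vfE map_lin_form; congr (_ * _).
by apply/mpolyP => m; rewrite !(mcoeff_map_mpoly, mcoeff_mderiv) raddfMn.
Qed.

Lemma map_mpoly_inj : injective (map_mpoly iota : Kx -> Lx).
Proof.
move=> p p' /mpolyP eqp; apply/mpolyP => m; have := eqp m.
by rewrite !mcoeff_map_mpoly => /fmorph_inj.
Qed.

Lemma invariants_map_rmorphism B phi :
  invariants (map_mx iota B) (map_mpoly iota phi) <-> invariants B phi.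
Proof.
rewrite /invariants /= lie_derivative_map_rmorphism; split=> [|->]; last exact: raddf0.
by rewrite -(raddf0 (map_mpoly iota)) => /map_mpoly_inj.
Qed.

Section SemilinearProjection.
Variable f : {additive L -> K}.
Hypothesis fZ : forall a z, f (iota a * z) = a * f z.

(** Linearity of [f] over [K] extends to linearity over [K[x]], since coefficients of a product are
    finite sums of products. *)
Lemma map_mpoly_semilinear p q : map_mpoly f (map_mpoly iota p * q) = p * map_mpoly f q.
Proof.
apply/mpolyP => m; rewrite mcoeff_map_mpoly !mcoeffM raddf_sum; apply: eq_bigr => k _.
by rewrite !mcoeff_map_mpoly fZ.
Qed.

Lemma map_mpoly_scale_map z p : map_mpoly f (z *: map_mpoly iota p) = f z *: p.
Proof.
apply/mpolyP => m; rewrite mcoeff_map_mpoly mcoeffZ [RHS]mcoeffZ mcoeff_map_mpoly.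
by rewrite mulrC fZ mulrC.
Qed.

Lemma map_mpoly_scale a q : map_mpoly f (iota a *: q) = a *: map_mpoly f q.
Proof. by apply/mpolyP => m; rewrite !(mcoeff_map_mpoly, mcoeffZ) fZ. Qed.

(** The components of [B x] have coefficients in [K], so [f] passes through them; partial
    derivatives only multiply coefficients by integers. *)
Lemma lie_derivative_map_mpoly B q :
  lie_derivative B (map_mpoly f q) = map_mpoly f (lie_derivative (map_mx iota B) q).
Proof.
rewrite /lie_derivative raddf_sum /=; apply: eq_bigr => j _.
by rewrite mderiv_map_mpoly !linear_vfE -map_lin_form mulrC -map_mpoly_semilinear mulrC.
Qed.

Lemma invariants_map_mpoly B q :
  invariants (map_mx iota B) q -> invariants B (map_mpoly f q).
Proof. by rewrite /invariants /= lie_derivative_map_mpoly => ->; exact: raddf0. Qed.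

End SemilinearProjection.

Variables (pi rho : {additive L -> K}) (omega : L).
Hypothesis piZ : forall a z, pi (iota a * z) = a * pi z.
Hypothesis rhoZ : forall a z, rho (iota a * z) = a * rho z.
Hypothesis pi1 : pi 1 = 1.
Hypothesis decomposition : forall z, z = iota (pi z) + omega * iota (rho z).

Lemma map_mpoly_decomposition q :
  q = map_mpoly iota (map_mpoly pi q) + omega *: map_mpoly iota (map_mpoly rho q).
Proof.
apply/mpolyP => m; rewrite mcoeffD mcoeffZ !mcoeff_map_mpoly; exact: decomposition.
Qed.

Lemma map_mpoly_projK p : map_mpoly pi (map_mpoly iota p) = p.
Proof. by rewrite -[map_mpoly iota p]scale1r map_mpoly_scale_map // pi1 scale1r. Qed.

(** Splitting [u] along [1] and [omega] leaves two factors over [K], which [f] lets through. *)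
Lemma map_mpoly_mul (f : {additive L -> K}) u v : (forall a z, f (iota a * z) = a * f z) ->
  map_mpoly f (u * v) =
  map_mpoly pi u * map_mpoly f v + map_mpoly rho u * map_mpoly f (omega *: v).
Proof.
move=> fZ; rewrite {1}(map_mpoly_decomposition u) mulrDl raddfD /= map_mpoly_semilinear //.
by rewrite -scalerAl scalerAr map_mpoly_semilinear.
Qed.

Lemma map_mpoly_scale_omega (f : {additive L -> K}) v :
  (forall a z, f (iota a * z) = a * f z) ->
  map_mpoly f (omega *: v) =
  f omega *: map_mpoly pi v + f (omega * omega) *: map_mpoly rho v.
Proof.
move=> fZ; rewrite {1}(map_mpoly_decomposition v) scalerDr raddfD /= scalerA.
by congr (_ + _); exact: map_mpoly_scale_map.
Qed.

(** The projections [pi] and [rho] of the generators generate over [K], and [pi] recovers any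
    invariant already defined over [K]. *)
Lemma subalgebra_descent B :
  (exists s, generates_subalgebra s (invariants (map_mx iota B))) ->
  exists s, generates_subalgebra s (invariants B).
Proof.
move=> [s [sB gen]].
exists (map (map_mpoly pi) s ++ map (map_mpoly rho) s); split.
  by move=> g; rewrite mem_cat => /orP[] /mapP[h /sB Bh ->]; exact: invariants_map_mpoly.
move=> N NC ND NM Ns phi phiB; rewrite -(map_mpoly_projK phi).
have NZ c p : N p -> N (c *: p) by move=> Np; rewrite -mul_mpolyC; exact: NM.
(* Both projections are carried along because each projection of a product involves both projections
   of its factors. *)
suff : N (map_mpoly pi (map_mpoly iota phi)) /\ N (map_mpoly rho (map_mpoly iota phi)) by case.
move: (map_mpoly iota phi) (proj2 (invariants_map_rmorphism B phi) phiB).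
apply: gen => [c|u v [piu rhou] [piv rhov]|u v [piu rhou] [piv rhov]|g gs].
- by rewrite !map_mpolyC; split; exact: NC.
- by rewrite !raddfD; split; exact: ND.
- rewrite !map_mpoly_mul // !map_mpoly_scale_omega //.
  by split; apply: (ND); apply: (NM) => //; apply: (ND); exact: NZ.
- split; apply: (Ns); rewrite mem_cat; apply/orP; [left|right]; exact: map_f.
Qed.

Lemma submodule_descent k (A : 'M[K]_k) B :
  (exists s, generates_submodule (invariants (map_mx iota B)) s
    (twisted_invariants (map_mx iota A) (map_mx iota B))) ->
  exists s, generates_submodule (invariants B) s (twisted_invariants A B).
Proof.
(* The new generators are [pi g] and [pi (omega g)]; [map_mpoly_mul] expands [pi (c g)] in exactly
   these two. *)
move=> [s [sM gen]]; pose proj z (w : 'cV[Lx]_k) := map_mx (map_mpoly pi) (mpolyC n z *: w).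
exists (map (proj 1) s ++ map (proj omega) s); split.
  have projM z w : twisted_invariants (map_mx iota A) (map_mx iota B) w ->
      twisted_invariants A B (proj z w).
    move=> wM i; rewrite !mxE lie_derivative_map_mpoly // mul_mpolyC linearZ /= wM.
    rewrite scaler_sumr raddf_sum; apply: eq_bigr => j _ /=.
    rewrite !mxE mul_mpolyC scalerA mulrC -scalerA.
    exact: map_mpoly_scale.
  by move=> g; rewrite mem_cat => /orP[] /mapP[h /sM Mh ->]; exact: projM.
move=> N N0 ND NZ Ns w wM.
have projD z (x y : 'cV[Lx]_k) : proj z (x + y) = proj z x + proj z y.
  by rewrite /proj scalerDr map_mxD.
have projZ z (c : Lx) (x : 'cV[Lx]_k) : proj z (c *: x) =
    map_mpoly pi (mpolyC n z * c) *: proj 1 x +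
    map_mpoly rho (mpolyC n z * c) *: proj omega x.
  apply/matrixP => i j.
  transitivity (map_mpoly pi (mpolyC n z * c) * proj 1 x i j +
      map_mpoly rho (mpolyC n z * c) * proj omega x i j); last first.
    by rewrite [RHS]mxE; congr (_ + _); rewrite [RHS]mxE.
  have projE y (t : 'cV[Lx]_k) : proj y t i j = map_mpoly pi (mpolyC n y * t i j).
    by rewrite /proj mxE [in LHS]mxE.
  rewrite !projE mxE mulrA (map_mpoly_mul _ _ piZ) mpolyC1 mul1r.
  by congr (_ + _ * map_mpoly pi _); rewrite mul_mpolyC.
suff : N (proj 1 (map_mx (map_mpoly iota) w)) /\ N (proj omega (map_mx (map_mpoly iota) w)).
  case=> + _; congr N; apply/matrixP => i j.
  by rewrite !mxE mpolyC1 mul1r map_mpoly_projK.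
have wM' : twisted_invariants (map_mx iota A) (map_mx iota B) (map_mx (map_mpoly iota) w).
  move=> i; rewrite mxE lie_derivative_map_rmorphism wM raddf_sum; apply: eq_bigr => j _ /=.
  by rewrite map_mpolyZ !mxE.
move: (map_mx _ w) wM'; apply: gen => [|x y [x1 xo] [y1 yo]|c x Bc [x1 xo]|g gs].
- by rewrite /proj !scaler0 map_mx0; split.
- by rewrite !projD; split; exact: ND.
- rewrite !projZ; split; apply: (ND); apply: (NZ) => //; apply: invariants_map_mpoly => //;
    by rewrite mul_mpolyC; exact: invariantsZ.
- split; apply: (Ns); rewrite mem_cat; apply/orP; [left|right]; exact: map_f.
Qed.

End Descent.

(** * The system [X_B w = A w] with both matrices diagonalized *)

Section DiagonalTwistedInvariants.
Variables (L : numFieldType) (n k : nat) (B P : 'M[L]_n) (d : 'rV[L]_n).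
Variables (A Q : 'M[L]_k) (e : 'rV[L]_k).
Hypotheses (Punit : P \in unitmx) (PB : P *m B = diag_mx d *m P).
Hypotheses (Qunit : Q \in unitmx) (QA : Q *m A = diag_mx e *m Q).
Local Notation Lx := (mpoly n L).

Lemma twisted_invariants_generated :
  exists s, generates_submodule (invariants B) s (twisted_invariants A B).
Proof.
have /choice[s sP] i := semi_invariants_generated Punit PB (e 0 i).
(* Column [i] of [invmx Q] is an eigenvector of [A] for [e 0 i], so its product with a
   semi-invariant of that weight solves the system. *)
pose c i : 'cV[Lx]_k := \col_j mpolyC n (invmx Q j i).
exists (flatten [seq [seq h *: c i | h <- s i] | i <- enum 'I_k]); split.
  move=> _ /flatten_mapP[i _ /mapP[h /(proj1 (sP i)) h_semi ->]] j.
  have cE l : (h *: c i) l 0 = invmx Q l i *: h by rewrite !mxE mulrC mul_mpolyC.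
  rewrite cE linearZ /= h_semi scalerA.
  under eq_bigr do rewrite cE scalerA; rewrite -scaler_suml; congr (_ *: _).
  have /matrixP/(_ j i) : A *m invmx Q = invmx Q *m diag_mx e.
    by rewrite -[A](mulKmx Qunit) QA !mulmxA mulmxK.
  by rewrite mul_mx_diag !mxE => ->.
move=> N N0 ND NZ Ns w wM.
(* The rows of [Q] are left eigenvectors of [A], so [Q w] decouples into scalar semi-invariants. *)
pose q i := \sum_j Q i j *: w j 0.
have q_semi i : semi_invariants (e 0 i) B (q i).
  rewrite /semi_invariants /= /q raddf_sum /=.
  under eq_bigr do rewrite linearZ /= wM scaler_sumr.
  rewrite exchange_big scaler_sumr; apply: eq_bigr => l _ /=.
  under eq_bigr do rewrite scalerA; rewrite -scaler_suml scalerA; congr (_ *: _).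
  by have /matrixP/(_ i l) := QA; rewrite mul_diag_mx !mxE.
have -> : w = \sum_i q i *: c i.
  apply/colP => j; rewrite summxE.
  transitivity (\sum_i \sum_l (invmx Q j i * Q i l) *: w l 0); last first.
    apply: eq_bigr => i _; rewrite !mxE mulrC mul_mpolyC scaler_sumr.
    by apply: eq_bigr => l _; rewrite scalerA.
  have QQ l : \sum_i invmx Q j i * Q i l = (j == l)%:R.
    by have /matrixP/(_ j l) := mulVmx Qunit; rewrite !mxE.
  rewrite exchange_big /=; under eq_bigr do rewrite -scaler_suml QQ.
  rewrite (bigD1 j) //= eqxx scale1r big1 ?addr0 // => l lj.
  by rewrite eq_sym (negbTE lj) scale0r.
apply: (big_ind N) => // i _.
apply: ((proj2 (sP i)) (fun h => N (h *: c i))) (q_semi i).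
- by rewrite scale0r.
- by move=> u v Nu Nv; rewrite scalerDl; exact: ND.
- by move=> a u Ba Nu; rewrite -scalerA; exact: NZ.
- move=> g gs; apply: Ns; apply/flatten_mapP; exists i; first by rewrite mem_enum.
  exact: map_f.
Qed.

End DiagonalTwistedInvariants.

(** * The flow of [B] and the invariants of the group *)

Section ToralGroup.
Variables (R : realType) (F : real_or_complex) (n : nat).
Local Notation K := (ground_field R F).
Local Notation C := (complex_field R).
Local Notation iota := (@embed R F).
Variables (B : 'M[K]_n) (P : 'M[C]_n) (d : 'rV[C]_n).
Hypotheses (Punit : P \in unitmx) (PB : P *m map_mx iota B = diag_mx d *m P).

Lemma cexpMn (z : C) k : cexp (z *+ k) = cexp z ^+ k.
Proof. by elim: k => [|k IH]; rewrite ?mulr0n ?cexp0 // mulrS cexpD IH exprS. Qed.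

Lemma eigen_coef_flow t m phi :
  eigen_coef P m (map_mpoly iota (lin_subst (mx_exp (t *: B)) phi)) =
  cexp (iota t * weight d m) * eigen_coef P m (map_mpoly iota phi).
Proof.
have PtB : P *m map_mx iota (t *: B) = diag_mx (iota t *: d) *m P.
  by rewrite map_mxZ -scalemxAr PB scalemxAl -linearZ.
have PE := mx_exp_diag Punit PtB.
rewrite (map_lin_subst (iota : {rmorphism K -> C})).
move: (map_mx _ _) (map_mpoly _ _) PE => E psi PE.
rewrite (eigen_coef_lin_subst Punit m psi PE).
congr (_ * _); rewrite /weight mulr_sumr (big_morph _ (@cexpD R) (@cexp0 R)).
by apply: eq_bigr => i _; rewrite !mxE mulrnAr cexpMn.
Qed.

(** If [y^m] occurs in a [phi] fixed by the flow, then [cexp (t <d, m>) = 1] for all real [t], which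
    forces weight zero; conversely weight zero makes every factor 1. *)
Lemma invariants_flow phi :
  invariants B phi <->
  forall t, t \is Num.real -> lin_subst (mx_exp (t *: B)) phi = phi.
Proof.
rewrite -(invariants_map_rmorphism iota) invariants_semi (semi_invariantsP Punit PB).
split=> [phi_semi t t_real|phi_flow m m_neq0].
  apply: (@map_mpoly_inj _ _ iota); apply: (eigen_coef_inj Punit) => m.
  apply: etrans (eigen_coef_flow t m phi) _.
  have [->|/phi_semi ->] := eqVneq (eigen_coef P m (map_mpoly iota phi)) 0.
    by rewrite mulr0.
  by rewrite mulr0 cexp0 mul1r.
apply: cexp_real_mul_eq1 => r; have [t t_real <-] := real_embed F r.
apply: (mulIf m_neq0); rewrite mul1r.
by apply: etrans (esym (eigen_coef_flow t m phi)) _; rewrite phi_flow.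
Qed.

(** For each fixed [x], the condition [phi (A x) = phi x] is polynomial in the entries of [A]; the
    stabilizer is cut out by these conditions for all [x]. *)
Lemma zariski_closed_stabilizer (phi : mpoly n K) :
  zariski_closed [set A | A \in unitmx /\ lin_subst A phi = phi].
Proof.
pose p (x : 'cV[K]_n) : mpoly (n * n) K :=
  comp_mpoly [tuple \sum_j x j 0 *: mpolyX K (mnm1 (mxvec_index i j)) | i < n] phi -
  mpolyC (n * n) (meval (fun i => x i 0) phi).
have pE x A : meval (fun i => mxvec A 0 i) (p x) =
    meval (fun i => (A *m x) i 0) phi - meval (fun i => x i 0) phi.
  rewrite /p mevalB mevalC comp_mpoly_meval; congr (_ - _); apply: meval_eq => i.
  rewrite tnth_mktuple raddf_sum mxE /=; apply: eq_bigr => j _.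
  by rewrite mevalZ mevalXU mxvecE mulrC.
exists (range p); apply/seteqP; split=> A /= [Aunit Aphi]; split=> //.
  move=> _ [x _ <-]; rewrite pE -meval_lin_subst Aphi; exact: subrr.
apply/eqP; rewrite -subr_eq0; apply/eqP/meval_eq0 => v.
have := Aphi (p (\col_i v i)) (ex_intro2 _ _ (\col_i v i) I erefl).
rewrite pE -meval_lin_subst -mevalB; congr (_ = _); apply: meval_eq => i.
by rewrite mxE.
Qed.

(** An invariant of [B] has a closed stabilizer containing the one-parameter group, so by density it
    contains [G]. Conversely the one-parameter group lies in [G], and polynomials agreeing at all
    points are equal. *)
Lemma invariants_group_invariants (G : set 'M[K]_n) :
  GL_subgroup G -> zariski_dense_in (one_parameter_group B) G ->
  invariants B = group_invariants G.
Proof.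
move=> [GU _ _ GV] [BG G_le]; apply/seteqP; split=> phi.
  move=> /invariants_flow phi_flow T GT x.
  have /G_le : one_parameter_group B `<=` [set A | A \in unitmx /\ lin_subst A phi = phi].
    by move=> _ [t t_real <-]; split; [apply/GU/BG; exists t|exact: phi_flow].
  move/(_ (zariski_closed_stabilizer phi))/(_ _ (GV _ GT)) => [_ Tphi].
  by rewrite -meval_lin_subst Tphi.
move=> phiG; apply/invariants_flow => t t_real.
have GT : G (mx_exp (t *: B)) by apply: BG; exists t.
apply/eqP; rewrite -subr_eq0; apply/eqP/meval_eq0 => v.
have := phiG _ (GV _ GT) (\col_i v i); rewrite invmxK -meval_lin_subst => phiT.
rewrite mevalB; apply/eqP; rewrite subr_eq0; apply/eqP.
have vE q : meval v q = meval (fun i => (\col_i v i : 'cV[K]_n) i 0) q.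
  by apply: meval_eq => i; rewrite mxE.
by rewrite !vE.
Qed.

End ToralGroup.

(** * Specialization to the real and complex ground fields *)

Lemma embed_decomposition (R : realType) (F : real_or_complex) :
  exists (pi rho : {additive complex_field R -> ground_field R F}) (omega : complex_field R),
  [/\ forall a z, pi (embed a * z) = a * pi z,
      forall a z, rho (embed a * z) = a * rho z,
      pi 1 = 1 &
      forall z, z = embed (pi z) + omega * embed (rho z)].
Proof.
rewrite /embed; case: F.
  exists (@complex.Re R), (@complex.Im R), (Complex 0 1); split=> //=.
  - by move=> a [x y] /=; rewrite mul0r subr0.
  - by move=> a [x y] /=; rewrite mul0r addr0.
  - exact: complexE.
(* Over the complex field nothing has to descend, and the second summand is zero. *)
exists idfun, \0, 0; split=> //= [a z|z]; first by rewrite mulr0.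
by rewrite mul0r addr0.
Qed.

(** The Jacobian of [x |-> B x] is [B], so component [i] of the bracket is [X_B (p_i) - (B p)_i]. *)
Lemma centralizerP (K : numFieldType) n (B : 'M[K]_n) (p : 'cV[mpoly n K]_n) :
  centralizer B p <-> twisted_invariants B B p.
Proof.
have bracketE i : lie_bracket (linear_vf B) p i 0 =
    lie_derivative B (p i 0) - \sum_j B i j *: p j 0.
  rewrite !mxE; congr (_ - _); apply: eq_bigr => j _; rewrite mxE //.
  by rewrite linear_vfE mderiv_lin_form mul_mpolyC.
split=> [pB i|pB].
  by apply/eqP; rewrite -subr_eq0 -bracketE pB mxE.
by apply/colP => i; rewrite bracketE pB mxE subrr.
Qed.

Theorem proposition4p2p8 (R : realType) (F : real_or_complex) (n : nat)
    (G : set 'M[ground_field R F]_n) (B : 'M[ground_field R F]_n) :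
  toral G -> semisimple B -> zariski_dense_in (one_parameter_group B) G ->
  [/\ fin_gen_subalgebra (invariants B) /\ invariants B = group_invariants G,
      forall chi : ground_field R F,
        fin_gen_submodule (V := (mpoly n (ground_field R F))^o)
          (invariants B) (semi_invariants chi B) &
      fin_gen_submodule (V := 'cV[mpoly n (ground_field R F)]_n)
        (invariants B) (centralizer B)].
Proof.
move=> [[G_group _] _ _] [P Punit /diagonalizable_forPex[d /(simmxP Punit) PB]] G_dense.
have [pi [rho [omega [piZ rhoZ pi1 decomposition]]]] := embed_decomposition R F.
have {}PB : P *m map_mx (@embed R F) B = diag_mx d *m P by [].
split.
- split; last exact: (invariants_group_invariants Punit PB).
  have [s] := subalgebra_descent piZ rhoZ pi1 decomposition (invariants_generated Punit PB).
  exact: generates_fin_gen_subalgebra.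
- move=> chi.
  (* The scalar [chi] is treated as a 1 by 1 matrix, already diagonal, and vectors of length one are
     then read as polynomials. *)
  have chiE : 1%:M *m map_mx (@embed R F) (chi%:M : 'M_1) =
      diag_mx (const_mx (embed chi)) *m 1%:M.
    by rewrite mul1mx mulmx1 diag_const_mx map_scalar_mx.
  have [s [sM gen]] := submodule_descent piZ rhoZ pi1 decomposition
    (twisted_invariants_generated Punit PB (unitmx1 _ _) chiE).
  apply: (@generates_fin_gen_submodule _ n (mpoly n (ground_field R F))^o B
    [seq w 0 0 | w : 'cV_1 <- s]).
  + by rewrite /semi_invariants /= raddf0 scaler0.
  + by move=> u v; rewrite /semi_invariants /= raddfD scalerDr /= => -> ->.
  + move=> a u; rewrite /semi_invariants /invariants /= lie_derivativeM => -> ->.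
    by rewrite mul0r add0r scalerAr.
  + split=> [_ /mapP[w /sM/(_ 0) + ->]|N N0 ND NZ Ns u u_semi].
      by rewrite big_ord1 mxE eqxx.
    have -> : u = (const_mx u : 'cV_1) 0 0 by rewrite mxE.
    apply: (gen (fun w => N (w 0 0))) => [|v w Nv Nw|a v Ba Nv|g gs|i].
    * by rewrite mxE.
    * by rewrite mxE; exact: ND.
    * by rewrite mxE; exact: NZ.
    * exact/Ns/(map_f (fun w : 'cV_1 => w 0 0)).
    * by rewrite big_ord1 !mxE !ord1 eqxx.
have cE : centralizer B = twisted_invariants B B.
  by apply/seteqP; split=> p /centralizerP.
have [s] := submodule_descent piZ rhoZ pi1 decomposition
  (twisted_invariants_generated Punit PB Punit PB).
rewrite cE; apply: generates_fin_gen_submodule => [i|u v uB vB i|a u aB uB i].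
- rewrite mxE raddf0 big1 // => j _; by rewrite mxE scaler0.
- rewrite mxE raddfD /= uB vB -big_split; apply: eq_bigr => j _.
  by rewrite mxE scalerDr.
- rewrite mxE lie_derivativeM aB mul0r add0r uB mulr_sumr; apply: eq_bigr => j _.
  by rewrite mxE scalerAr.
Qed.
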